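(* Let $\tilde\Delta_{k-1}=\{\boldsymbol\pi\in\mathbb{R}^{k-1}:\sum_{i=1}^{k-1}\pi_i\le1,\ \pi_i\ge0,\ i=1,\dots,k-1\}$. Let the null hypothesis set be the $(k-1)$-dimensional polytope $$\mathcal{P}_0=\{\boldsymbol\pi\in\tilde\Delta_{k-1}:\mathbf a_i^\intercal\boldsymbol\pi-b_i\ge0,\ i=1,\dots,m\},\qquad \emptyset\ne\mathcal{P}_0\ne\tilde\Delta_{k-1},$$ with $\mathbf a_i\in\mathbb{R}^{k-1}$, $b_i\in\mathbb{R}$. Put $H_i=\{\boldsymbol\pi\in\mathbb{R}^{k-1}:\mathbf a_i^\intercal\boldsymbol\pi=b_i\}$, and assume that $H_1,\dots,H_m$ are pairwise distinct affine hyperplanes and that, for each $i$, the facet $H_i\cap\mathcal{P}_0$ of the polytope is $(k-2)$-dimensional and $H_i$ intersects $\mathrm{int}(\tilde\Delta_{k-1})$. Then there exists an NTUB test (respectively, an SUB test) of $\mathcal{P}_0$ against $\tilde\Delta_{k-1}\setminus\mathcal{P}_0$ for some sample size if and only if for every $i\ne j$ the set $H_i\cap H_j\cap\mathcal{P}_0$ is contained in the boundary of $\tilde\Delta_{k-1}$.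
   Context: Fix $k\ge2$ and let $\Delta_{k-1}=\{\boldsymbol\pi\in\mathbb{R}^k:\pi_i\ge0,\ \sum_{i=1}^k\pi_i=1\}$, identified with $\tilde\Delta_{k-1}\subset\mathbb{R}^{k-1}$ by projection onto the first $k-1$ coordinates (so $\pi_k=1-\sum_{i<k}\pi_i$). Interior and boundary of $\tilde\Delta_{k-1}$ are Euclidean, in $\mathbb{R}^{k-1}$. The data are $\mathbf X\sim\text{Multinomial}_k(\boldsymbol\pi,n)$, $n$ being the sample size. A (randomized) test for sample size $n$ is a function $\phi:\{\mathbf x\in\mathbb{N}^k:\sum_i x_i=n\}\to[0,1]$; its power function is $\beta_\phi(\boldsymbol\pi)=E_{\boldsymbol\pi}(\phi(\mathbf X))=\sum_{\mathbf x}\phi(\mathbf x)\frac{n!}{x_1!\cdots x_k!}\prod_{i=1}^k\pi_i^{x_i}$. For a null set $\mathcal{P}_0$ and alternative $\mathcal{P}_A$ (its complement in the simplex), $\phi$ is unbiased if $\beta_\phi(\boldsymbol\pi_0)\le\beta_\phi(\boldsymbol\pi_A)$ for all $\boldsymbol\pi_0\in\mathcal{P}_0$, $\boldsymbol\pi_A\in\mathcal{P}_A$; it is non-trivial unbiased (NTUB) if it is unbiased and $\beta_\phi$ is not constant on the simplex; it is strictly unbiased (SUB) if $\beta_\phi(\boldsymbol\pi_0)<\beta_\phi(\boldsymbol\pi_A)$ for all such pairs. *)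

(* Defs.v *)
From HB Require Import structures.
From mathcomp Require Import all_boot all_order all_algebra.
From mathcomp Require Import all_classical all_reals all_analysis.
Import numFieldNormedType.Exports.
Import Order.TTheory GRing.Theory Num.Theory.

Set Implicit Arguments.
Unset Strict Implicit.
Unset Printing Implicit Defensive.

Local Open Scope classical_set_scope.
Local Open Scope ring_scope.

(* Points of R^d are row vectors.  The topology of 'rV[R]_d is that of the    *)
(* sup norm, i.e. the Euclidean one.                                          *)

Definition dotrv (R : realType) (d : nat) (u v : 'rV[R]_d) : R :=
  \sum_(j < d) u 0 j * v 0 j.

Definition boundary (T : topologicalType) (A : set T) : set T :=
  closure A `\` interior A.

Definition affine_hull (R : realType) (d : nat) (S : set 'rV[R]_d) :
    set 'rV[R]_d :=
  [set x | exists (r : nat) (p : 'I_r -> 'rV[R]_d) (w : 'I_r -> R),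
    [/\ forall i, S (p i), \sum_(i < r) w i = 1
      & x = \sum_(i < r) w i *: p i]].

(* The empty set has no dimension: its affine hull is empty.                  *)
Definition has_affine_dim (R : realType) (d : nat) (S : set 'rV[R]_d)
    (e : nat) : Prop :=
  exists (x0 : 'rV[R]_d) (V : {vspace 'rV[R]_d}),
    affine_hull S = [set x0 + v | v in [set` V]] /\ \dim V = e.

Definition hyperplane (R : realType) (d : nat) (a : 'rV[R]_d) (b : R) :
    set 'rV[R]_d :=
  [set p | dotrv a p = b].

Definition proj_simplex (R : realType) (d : nat) : set 'rV[R]_d :=
  [set p | \sum_(i < d) p 0 i <= 1 /\ forall i, 0 <= p 0 i].
Arguments proj_simplex : clear implicits.

Definition null_polytope (R : realType) (d m : nat) (a : 'I_m -> 'rV[R]_d)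
    (b : 'I_m -> R) : set 'rV[R]_d :=
  [set p | proj_simplex R d p /\ forall i, 0 <= dotrv (a i) p - b i].

(* The k cell probabilities coded by their first k - 1 values: [insub] fails  *)
(* exactly at the last index.                                                 *)
Definition cell_prob (R : realType) (k : nat) (p : 'rV[R]_k.-1) (i : 'I_k) : R :=
  if (insub (i : nat) : option 'I_k.-1) is Some j then p 0 j
  else 1 - \sum_(j < k.-1) p 0 j.

Definition counts (k n : nat) : finType :=
  {x : {ffun 'I_k -> 'I_n.+1} | (\sum_(i < k) x i == n)%N}.

Definition multinomial_pmf (R : realType) (k n : nat) (p : 'rV[R]_k.-1)
    (x : counts k n) : R :=
  n`!%:R / (\prod_(i < k) (val x i)`!)%:R
  * \prod_(i < k) cell_prob p i ^+ val x i.

Definition is_test (R : realType) (k n : nat) (phi : counts k n -> R) : Prop :=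
  forall x, 0 <= phi x <= 1.

Definition power (R : realType) (k n : nat) (phi : counts k n -> R)
    (p : 'rV[R]_k.-1) : R :=
  \sum_(x : counts k n) phi x * multinomial_pmf p x.

Definition unbiased (R : realType) (k n : nat) (phi : counts k n -> R)
    (P0 PA : set 'rV[R]_k.-1) : Prop :=
  forall p0 pA, P0 p0 -> PA pA -> power phi p0 <= power phi pA.

Definition NTUB (R : realType) (k n : nat) (phi : counts k n -> R)
    (P0 PA : set 'rV[R]_k.-1) : Prop :=
  unbiased phi P0 PA /\
  ~ exists c : R, forall p, proj_simplex R k.-1 p -> power phi p = c.

Definition SUB (R : realType) (k n : nat) (phi : counts k n -> R)
    (P0 PA : set 'rV[R]_k.-1) : Prop :=
  forall p0 pA, P0 p0 -> PA pA -> power phi p0 < power phi pA.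

(* Main.v *)
(* A power function is a polynomial, and every product of affine functions is,
   up to a positive affine rescaling, a power function.

   If the hyperplanes do not meet in the polytope inside the simplex, then at
   each point of the alternative exactly one constraint is violated and all
   others hold strictly, so the negated product of the constraints defines a
   strictly unbiased test.

   Conversely, let c separate the values of the power function on the null
   polytope and on the alternative.  Crossing the facet on the i-th hyperplane,
   the power minus c changes sign; crossing the same hyperplane where the j-th
   constraint is violated, it does not.  On a plane transversal to the i-th
   hyperplane, the parity of the order of vanishing along it would be both odd
   and even. *)

Require Import Defs.
From HB Require Import structures.
From mathcomp Require Import all_boot all_order all_algebra.
From mathcomp Require Import all_classical all_reals all_analysis.
From mathcomp Require Import ring lra.
Import numFieldNormedType.Exports.
Import Order.TTheory GRing.Theory Num.Theory.
Local Open Scope classical_set_scope.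
Local Open Scope ring_scope.

(** * Signs of polynomials near a point and near a line *)

Lemma near_subset (T : topologicalType) (p : T) (A B : set T) :
  A `<=` B -> (\forall q \near p, A q) -> \forall q \near p, B q.
Proof. exact: filterS. Qed.

Lemma forall_gt_near (R : realType) (T : topologicalType) (I : finType)
    (f : I -> T -> R) (c : I -> R) (p : T) :
  (forall i, continuous (f i)) -> (forall i, c i < f i p) ->
  \forall q \near p, forall i, c i < f i q.
Proof.
by move=> fc fp; apply: filter_forall => i; exact: (cvgr_gt _ (fc i p)).
Qed.

Lemma forall_in_near (T : topologicalType) (I : finType) (P : pred I)
    (f : I -> T -> Prop) (p : T) :
  (forall i, P i -> \forall q \near p, f i q) ->
  \forall q \near p, forall i, P i -> f i q.
Proof.
move=> fp; apply: (@filter_forall _ _ (fun i q => P i -> f i q)) => i.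
have [/fp|_] := boolP (P i); last exact: nearW.
exact: filterS.
Qed.

Lemma horner_gt0_near (R : realType) (p : {poly R}) (s : R) :
  0 < p.[s] -> \forall t \near s, 0 < p.[t].
Proof. by move=> ps; exact: (cvgr_gt _ (@continuous_horner R p s)). Qed.

Lemma affine_gt0_near (R : realType) (u v s : R) :
  0 < u + s * v -> \forall t \near s, 0 < u + t * v.
Proof.
have E t : u + t * v = (u%:P + v *: 'X).[t] by rewrite !hornerE mulrC.
rewrite E => /horner_gt0_near; apply: filterS => t; by rewrite E.
Qed.

Lemma horner_neq0_near (R : realType) (p : {poly R}) (s : R) :
  p != 0 -> \forall t \near s^', p.[t] != 0.
Proof.
move=> p0; have [n [q]] := multiplicity_XsubC p s.
rewrite p0 /= => qs ->; rewrite /dnbhs /within /=.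
(* Squaring the cofactor [q] turns nonvanishing into positivity, which is known to be an open
   condition. *)
have : 0 < (q ^+ 2).[s] by rewrite horner_exp exprn_even_gt0.
move=> /horner_gt0_near; apply: filterS => t; rewrite horner_exp exprn_even_gt0 //=.
by move=> qt ts; rewrite !hornerE /= mulf_neq0 // expf_neq0 // subr_eq0.
Qed.

(* Writing [F = X ^+ e * G] with [G.[0] != 0], the product of the values of [F]
   on both sides of the line [t = 0] has the sign of [(-1) ^+ e], except near
   the finitely many roots [s] of [G.[0]]. *)
Lemma parity_across_line (R : realType) (F : {poly {poly R}}) : F != 0 ->
  exists (e : nat) (h : {poly R}), h != 0 /\ forall s, h.[s] != 0 ->
    \forall t \near 0^', 0 < (-1) ^+ e * (F.[t%:P].[s] * F.[(- t)%:P].[s]).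
Proof.
move=> F0; have [e [G]] := multiplicity_XsubC F 0.
rewrite F0 /= subr0 => G0 FE; exists e, G.[0]; split=> // s hs.
pose g := map_poly (horner_eval s) G.
have gE t : G.[t%:P].[s] = g.[t].
  by rewrite -[g.[t]]/(map_poly (horner_eval s) G).[t]
    -{2}[t](hornerC t s) -[_.[s] in RHS]/(horner_eval s t%:P) horner_map.
(* The product [g(t) g(-t)] equals [g(0) ^+ 2] at [t = 0], so it stays positive nearby. *)
have g0 : 0 < (g * (g \Po (- 'X))).[0].
  rewrite hornerM horner_comp !hornerE oppr0 -gE -expr2 exprn_even_gt0 //=.
have := horner_gt0_near _ _ _ g0; rewrite /dnbhs /within /=.
apply: filterS => t.
rewrite hornerM horner_comp hornerN hornerX -!gE => gt0 t0.
rewrite FE !hornerM !hornerXn !horner_exp !hornerC.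
have -> : (-1) ^+ e * (G.[t%:P].[s] * t ^+ e * (G.[(- t)%:P].[s] * (- t) ^+ e))
  = (t ^+ e) ^+ 2 * (G.[t%:P].[s] * G.[(- t)%:P].[s]).
  rewrite [(- t) ^+ e]exprNn; set z := (-1) ^+ e.
  have z2 : z * z = 1 by rewrite -exprD addnn -mul2n exprM sqrrN !expr1n.
  by ring: z2.
by rewrite mulr_gt0 // exprn_even_gt0 //= expf_neq0.
Qed.

(** The exponent [e] is chosen before the base point [s0] and the affine conditions, so one parity
    serves at two distant places of the line [t = 0]. Finitely many strict affine conditions are
    open: first [s] is moved slightly to avoid the roots of [h], then [t] is taken small. *)
Lemma parity_near_line (R : realType) (F : {poly {poly R}}) : F != 0 ->
  exists e : nat, forall (I : finType) (P : pred I) (u v w : I -> R) (s0 : R),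
  (forall i, P i -> 0 < u i + s0 * v i) ->
  exists s t : R, [/\ t != 0,
    forall i, P i -> 0 < u i + s * v i + t * w i,
    forall i, P i -> 0 < u i + s * v i + (- t) * w i &
    0 < (-1) ^+ e * (F.[t%:P].[s] * F.[(- t)%:P].[s])].
Proof.
move=> /parity_across_line[e [h [h0 hF]]]; exists e => I P u v w s0 uv.
have Hs : \forall s \near s0^', forall i, P i -> 0 < u i + s * v i.
  apply: nbhs_dnbhs.
  apply: (@forall_in_near R I P (fun i s => 0 < u i + s * v i) s0) => i Pi.
  exact: affine_gt0_near (uv i Pi).
have [s [hs us]] := filter_ex (filterI (horner_neq0_near _ _ s0 h0) Hs).
pose f i t := 0 < u i + s * v i + t * w i /\ 0 < u i + s * v i + (- t) * w i.
have Ht : \forall t \near 0^', forall i, P i -> f i t.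
  apply: nbhs_dnbhs; apply: (@forall_in_near R I P f 0) => i Pi.
  have H1 : 0 < u i + s * v i + 0 * w i by rewrite mul0r addr0 us.
  have H2 : 0 < u i + s * v i + 0 * (- w i) by rewrite mul0r addr0 us.
  apply: near_subset
    (filterI (affine_gt0_near _ _ _ _ H1) (affine_gt0_near _ _ _ _ H2)).
  by move=> t [p1 p2]; split=> //; rewrite mulNr -mulrN.
have [t [t0 [ut Ft]]] :=
  filter_ex (filterI (nbhs_dnbhs_neq _) (filterI Ht (hF s hs))).
by exists s, t; split=> // i /ut[].
Qed.

(** * Scalar products, affine hulls and averages *)

Lemma dotrvD (R : realType) (d : nat) (u v w : 'rV[R]_d) :
  dotrv u (v + w) = dotrv u v + dotrv u w.
Proof.
by rewrite /dotrv -big_split; apply: eq_bigr => j _; rewrite mxE mulrDr.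
Qed.

Lemma dotrvZ (R : realType) (d : nat) (u v : 'rV[R]_d) (t : R) :
  dotrv u (t *: v) = t * dotrv u v.
Proof.
by rewrite /dotrv mulr_sumr; apply: eq_bigr => j _; rewrite mxE mulrCA.
Qed.

Lemma dotrv0 (R : realType) (d : nat) (u : 'rV[R]_d) : dotrv u 0 = 0.
Proof. by rewrite -[X in dotrv u X](scale0r 0) dotrvZ mul0r. Qed.

Lemma dotrvB (R : realType) (d : nat) (u v w : 'rV[R]_d) :
  dotrv u (v - w) = dotrv u v - dotrv u w.
Proof. by rewrite dotrvD -scaleN1r dotrvZ mulN1r. Qed.

Lemma dotrv_sum (R : realType) (d : nat) (u : 'rV[R]_d) (I : finType)
    (w : I -> R) (p : I -> 'rV[R]_d) :
  dotrv u (\sum_i w i *: p i) = \sum_i w i * dotrv u (p i).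
Proof.
have E : {morph dotrv u : x y / x + y >-> x + y} by move=> x y; exact: dotrvD.
by rewrite (big_morph _ E (dotrv0 _ _ _)); apply: eq_bigr => i _; exact: dotrvZ.
Qed.

Lemma dotrvv_gt0 (R : realType) (d : nat) (u : 'rV[R]_d) :
  u != 0 -> 0 < dotrv u u.
Proof.
move=> u0; have /existsP[j uj] : [exists j, u 0 j != 0].
  rewrite -negb_forall; apply: contra u0 => /forallP u0.
  by apply/eqP/rowP => j; rewrite mxE (eqP (u0 j)).
rewrite /dotrv (bigD1 j) //= ltr_pwDl //; first by rewrite -expr2 exprn_even_gt0.
by apply: sumr_ge0 => l _; rewrite -expr2 sqr_ge0.
Qed.

Lemma dotrv_continuous (R : realType) (d : nat) (u : 'rV[R]_d) :
  continuous (dotrv u).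
Proof.
rewrite /dotrv; apply: continuous_big => [|j _ x]; first exact: add_continuous.
apply: (@continuous_comp _ _ _ (fun v : 'rV[R]_d => v 0 j) (fun y => u 0 j * y)).
  exact: coord_continuous.
exact: mulrl_continuous.
Qed.

(** The direction space [V] of the hull is orthogonal to [a] and has codimension 1, so [V] and the
    line of [a] span everything; a difference of two points of the hyperplane has no component along
    [a]. *)
Lemma affine_hull_hyperplane (R : realType) (d : nat) (a : 'rV[R]_d.+1) (b : R)
    (S : set 'rV[R]_d.+1) :
  a != 0 -> S `<=` hyperplane a b -> has_affine_dim S d ->
  affine_hull S = hyperplane a b.
Proof.
move=> a0 SH [x0 [V [SV dV]]].
have aff_sub : affine_hull S `<=` hyperplane a b.
  move=> _ [r [p [w [Sp w1 ->]]]]; rewrite /hyperplane /= dotrv_sum.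
  by under eq_bigr do rewrite (SH _ (Sp _)); rewrite -mulr_suml w1 mul1r.
have hx0 v : v \in V -> dotrv a (x0 + v) = b.
  by move=> vV; apply: aff_sub; rewrite SV; exists v.
have ax0 : dotrv a x0 = b by rewrite -[x0]addr0 hx0 // mem0v.
have Va v : v \in V -> dotrv a v = 0.
  move=> /hx0; rewrite dotrvD ax0 => /eqP.
  by rewrite -subr_eq0 addrC addKr => /eqP.
have aa := dotrvv_gt0 _ _ _ a0.
have Vfull : (V + <[a]> = fullv)%VS.
  apply/eqP; rewrite eqEdim subvf dimvf dim_matrix mul1r /=.
  rewrite dimv_disjoint_sum ?dim_vline ?a0 ?dV ?addn1 //.
  apply/eqP; rewrite -subv0; apply/subvP => v /memv_capP[vV /vlineP[t vt]].
  move: (Va _ vV); rewrite vt dotrvZ => /eqP; rewrite mulf_eq0 (gt_eqF aa) orbF.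
  by move=> /eqP ->; rewrite scale0r mem0v.
apply/seteqP; split=> // y ay; rewrite SV.
exists (y - x0); last by rewrite addrC subrK.
have : y - x0 \in (V + <[a]>)%VS by rewrite Vfull memvf.
move=> /memv_addP[v vV [_ /vlineP[t ->]] yE].
suff t0 : t = 0 by rewrite /= yE t0 scale0r addr0.
have : dotrv a (y - x0) = 0 by rewrite dotrvB ay ax0 subrr.
rewrite yE dotrvD Va // add0r dotrvZ => /eqP.
by rewrite mulf_eq0 (gt_eqF aa) orbF => /eqP.
Qed.

(** The barycentre of one witness per index works: in each constraint all terms are nonnegative and
    the index's own witness contributes a positive one. *)
Lemma average_gt0 (R : realType) (d : nat) (I : finType) (a : 'rV[R]_d) (b : R)
    (g : I -> 'rV[R]_d) (c : I -> R) (P : pred I)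
    (S := [set p | dotrv a p = b /\ forall i, 0 <= dotrv (g i) p - c i]) :
  S !=set0 ->
  (forall i, P i -> exists2 p, S p & 0 < dotrv (g i) p - c i) ->
  exists2 p, S p & forall i, P i -> 0 < dotrv (g i) p - c i.
Proof.
move=> [p0 Sp0] SP; case: (pickP (@predT I)) => [i0 _|I0]; last first.
  by exists p0 => // i; have := I0 i.
have /choice[p pP] : forall i, exists p, S p /\ (P i -> 0 < dotrv (g i) p - c i).
  move=> i; case: (boolP (P i)) => [/SP[p Sp gp]|_]; last by exists p0.
  by exists p.
have n0 : 0 < #|I|%:R :> R by rewrite ltr0n; apply/card_gt0P; exists i0.
pose w (i : I) : R := #|I|%:R^-1.
have w1 : \sum_i w i = 1.
  by rewrite sumr_const -[LHS]mulr_natr mulVf // gt_eqF.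
have wE u e : dotrv u (\sum_i w i *: p i) - e = \sum_i w i * (dotrv u (p i) - e).
  rewrite dotrv_sum -{1}[e]mul1r -w1 mulr_suml -sumrB.
  by apply: eq_bigr => i _; rewrite mulrBr.
have w0 i : 0 < w i by rewrite invr_gt0.
have pw0 i j : 0 <= w j * (dotrv (g i) (p j) - c i).
  by rewrite mulr_ge0 ?(ltW (w0 j)) //; case: (pP j) => -[_ ->].
exists (\sum_i w i *: p i).
  rewrite /S /=; split=> [|i].
    apply/eqP; rewrite -subr_eq0 wE big1 // => i _.
    by have [[-> _] _] := pP i; rewrite subrr mulr0.
  by rewrite wE sumr_ge0.
move=> i Pi; rewrite wE (bigD1 i) //= ltr_pwDl //.
  by rewrite mulr_gt0 //; have [_ ->] := pP i.
by rewrite sumr_ge0.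
Qed.

(** * Cell probabilities as affine functions, and the interior of the simplex *)

Definition cell_normal (R : realType) (k : nat) (i : 'I_k) : 'rV[R]_k.-1 :=
  if insub (i : nat) is Some j then delta_mx 0 j else const_mx (-1).

Definition cell_offset (R : realType) (k : nat) (i : 'I_k) : R :=
  if (insub (i : nat) : option 'I_k.-1) is Some j then 0 else -1.

Lemma cell_probE (R : realType) (k : nat) (p : 'rV[R]_k.-1) (i : 'I_k) :
  cell_prob p i = dotrv (cell_normal R k i) p - cell_offset R k i.
Proof.
rewrite /cell_prob /cell_normal /cell_offset; case: insub => [j|].
  rewrite subr0 /dotrv (bigD1 j) //= mxE !eqxx mul1r big1 ?addr0 // => l lj.
  by rewrite mxE (negPf lj) andbF mul0r.
rewrite opprK addrC; congr +%R; rewrite -sumrN; apply: eq_bigr => j _.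
by rewrite mxE mulN1r.
Qed.

Lemma cell_normal_neq0 (R : realType) (k : nat) (i : 'I_k) :
  (1 < k)%N -> cell_normal R k i != 0.
Proof.
case: k i => [|[|d]] // i _; rewrite /cell_normal; case: insub => [j|].
  by apply/eqP => /matrixP/(_ 0 j)/eqP; rewrite !mxE !eqxx oner_eq0.
by apply/eqP => /matrixP/(_ 0 ord0)/eqP; rewrite !mxE oppr_eq0 oner_eq0.
Qed.

Lemma cell_prob_widen (R : realType) (d : nat) (p : 'rV[R]_d) (j : 'I_d) :
  @cell_prob R d.+1 p (widen_ord (leqnSn d) j) = p 0 j.
Proof. by rewrite /cell_prob /= valK. Qed.

Lemma cell_prob_last (R : realType) (d : nat) (p : 'rV[R]_d) :
  @cell_prob R d.+1 p ord_max = 1 - \sum_(j < d) p 0 j.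
Proof. by rewrite /cell_prob insubF //= ltnn. Qed.

Lemma sum_cell_prob (R : realType) (k : nat) (p : 'rV[R]_k.-1) :
  (0 < k)%N -> \sum_i cell_prob p i = 1.
Proof.
case: k p => // d p _; rewrite big_ord_recr /= cell_prob_last.
by under eq_bigr do rewrite cell_prob_widen; rewrite addrC subrK.
Qed.

(** Since the cell probabilities sum to 1, the constant term can be spread over them; the
    coefficients are the values of the affine function at the vertices of the simplex, the last
    vertex being the origin. *)
Lemma affine_cell_prob (R : realType) (k : nat) (a : 'rV[R]_k.-1) (b : R) :
  (0 < k)%N -> exists g : 'I_k -> R,
  forall p, dotrv a p - b = \sum_i g i * cell_prob p i.
Proof.
case: k a => // d a _.
exists (fun i : 'I_d.+1 => oapp (a 0) 0 (insub (i : nat)) - b) => p.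
under eq_bigr do rewrite mulrBl.
rewrite sumrB -mulr_sumr (sum_cell_prob _ d.+1) // mulr1; congr (_ - _).
rewrite big_ord_recr /= insubF /= ?ltnn // mul0r addr0 /dotrv.
by apply: eq_bigr => j _; rewrite cell_prob_widen valK.
Qed.

Lemma proj_simplexP (R : realType) (k : nat) (p : 'rV[R]_k.-1) :
  (0 < k)%N -> proj_simplex R k.-1 p <-> forall i, 0 <= cell_prob p i.
Proof.
case: k p => // d p _; split=> [[p1 p0] i|p0].
  by rewrite /cell_prob; case: insub => [j|]; rewrite ?p0 // subr_ge0.
split=> [|j]; last by have := p0 (widen_ord (leqnSn d) j); rewrite cell_prob_widen.
by have := p0 ord_max; rewrite cell_prob_last subr_ge0.
Qed.

Lemma interior_proj_simplexP (R : realType) (k : nat) (p : 'rV[R]_k.-1) :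
  (1 < k)%N -> (proj_simplex R k.-1)° p <-> forall i, 0 < cell_prob p i.
Proof.
move=> k1; have k0 : (0 < k)%N := ltnW k1; split=> [pT i|p0].
  set u := cell_normal R k i.
  have u0 : 0 < dotrv u u by apply/dotrvv_gt0/cell_normal_neq0.
  (* Moving from [p] against the normal [u] stays in the simplex for small [t > 0] but lowers the
     cell probability by [t * dotrv u u], so it was positive at [p]. *)
  have pc : (fun t : R => p - t *: u) @ 0^'+ --> p.
    apply: cvg_at_right_filter.
    rewrite -[X in _ --> X]subr0 -[X in _ - X](scale0r u).
    by apply: cvgB; [exact: cvg_cst | apply: cvgZ; [exact: cvg_id | exact: cvg_cst]].
  near (0 : R)^'+ => t.
  have t0 : 0 < t by near: t; exact: nbhs_right_gt.
  have : proj_simplex R k.-1 (p - t *: u) by near: t; exact: (pc _ pT).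
  move=> /(proj_simplexP _ _ _ k0)/(_ i).
  rewrite !cell_probE dotrvB dotrvZ -/u => H.
  have : 0 < t * dotrv u u by rewrite mulr_gt0.
  by move: H; lra.
have : \forall q \near p, forall i,
    cell_offset R k i < dotrv (cell_normal R k i) q.
  apply: (forall_gt_near _ _ _ (fun i q => dotrv (cell_normal R k i) q)) => i.
    exact: dotrv_continuous.
  by have := p0 i; rewrite cell_probE subr_gt0.
apply: near_subset => q q0; apply/proj_simplexP => // i.
by rewrite cell_probE subr_ge0 ltW.
Unshelve. all: by end_near.
Qed.
(** The restriction to a plane is a polynomial with [t] as outer and [s] as inner variable, the form
    in which the order of vanishing along [t = 0] can be read off. *)
Lemma power_plane (R : realType) (k n : nat) (phi : counts k n -> R)
    (x u v : 'rV[R]_k.-1) :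
  exists F : {poly {poly R}},
    forall s t, F.[t%:P].[s] = power phi (x + s *: u + t *: v).
Proof.
pose l w i := dotrv (cell_normal R k i) w.
pose cell (i : 'I_k) : {poly {poly R}} :=
  (cell_prob x i)%:P%:P + (l u i *: 'X)%:P + (l v i)%:P *: 'X.
have cellE s t i : (cell i).[t%:P].[s] = cell_prob (x + s *: u + t *: v) i.
  by rewrite !hornerE !cell_probE !dotrvD !dotrvZ /l; ring.
exists (\sum_y (phi y)%:P%:P *
  ((n`!%:R / (\prod_(i < k) (val y i)`!)%:R)%:P%:P *
    \prod_i cell i ^+ val y i)) => s t.
rewrite !horner_sum; apply: eq_bigr => y _.
rewrite !hornerM !hornerC /multinomial_pmf; congr (_ * (_ * _)).
by rewrite !horner_prod; apply: eq_bigr => i _; rewrite !horner_exp cellE.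
Qed.

(** * Ordered samples, and tests whose power is a prescribed product *)

Lemma sum_occurrences (k n : nat) (f : {ffun 'I_n -> 'I_k}) :
  (\sum_r #|[pred i | f i == r]| = n)%N.
Proof.
rewrite -[RHS]card_ord -sum1_card (partition_big f predT) //=.
by apply: eq_bigr => r _; rewrite sum1_card.
Qed.

Fact occurrences_subproof (k n : nat) (f : {ffun 'I_n -> 'I_k}) :
  (\sum_(r < k) ([ffun r => inord #|[pred i | f i == r]|] :
     {ffun 'I_k -> 'I_n.+1}) r == n)%N.
Proof.
rewrite -[X in _ == X](sum_occurrences _ _ f); apply/eqP/eq_bigr => r _.
rewrite ffunE inordK // ltnS -[X in (_ <= X)%N](sum_occurrences _ _ f).
by rewrite (bigD1 r) //= leq_addr.
Qed.

Definition occurrences (k n : nat) (f : {ffun 'I_n -> 'I_k}) : counts k n :=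
  exist (fun x : {ffun 'I_k -> 'I_n.+1} => \sum_(r < k) x r == n)%N _
    (occurrences_subproof k n f).

Lemma val_occurrences (k n : nat) (f : {ffun 'I_n -> 'I_k}) (r : 'I_k) :
  val (occurrences k n f) r = #|[pred i | f i == r]| :> nat.
Proof.
rewrite /= ffunE inordK // ltnS -[X in (_ <= X)%N](sum_occurrences _ _ f).
by rewrite (bigD1 r) //= leq_addr.
Qed.

Lemma prod_occurrences (R : realType) (k n : nat) (f : {ffun 'I_n -> 'I_k})
    (c : 'I_k -> R) :
  \prod_i c (f i) = \prod_r c r ^+ val (occurrences k n f) r.
Proof.
rewrite (partition_big f predT) //=; apply: eq_bigr => r _.
rewrite -[in RHS]/(val (occurrences k n f) r) val_occurrences.
by under eq_bigr => i /eqP -> do []; rewrite prodr_const.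
Qed.

(* A function of the ordered sample, averaged over the orderings compatible
   with the counts. *)
Definition sample_average (R : realType) (k n : nat)
    (w : {ffun 'I_n -> 'I_k} -> R) (y : counts k n) : R :=
  (\sum_(f | occurrences k n f == y) w f)
  / (n`!%:R / (\prod_(i < k) (val y i)`!)%:R).

(** The sum over ordered samples is grouped by counts: the probability of a sample depends only on
    its counts, and the divisor in [sample_average] cancels the multinomial coefficient. *)
Lemma power_sample_average (R : realType) (k n : nat)
    (w : {ffun 'I_n -> 'I_k} -> R) (p : 'rV[R]_k.-1) :
  power (sample_average R k n w) p = \sum_f w f * \prod_i cell_prob p (f i).
Proof.
rewrite [RHS](partition_big (occurrences k n) predT) //=.
apply: eq_bigr => y _; rewrite /sample_average /multinomial_pmf mulrA.
rewrite divfK; last first.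
  rewrite mulf_neq0 ?invr_eq0 ?pnatr_eq0 -?lt0n ?fact_gt0 //.
  by apply: prodn_gt0 => i; exact: fact_gt0.
rewrite mulr_suml; apply: eq_bigr => f /eqP <-.
by rewrite prod_occurrences.
Qed.

(** Expanding the product of [n] linear forms in the cell probabilities gives a sum over ordered
    samples with weights [w f]. The weights [M - w f] are nonnegative, and [M] contributes a
    constant because the probabilities of all samples sum to 1; dividing by [K] brings the values
    below 1. *)
Lemma exists_test_prod (R : realType) (k n : nat) (L : 'I_n -> 'rV[R]_k.-1 -> R) :
  (0 < k)%N ->
  (forall i, exists g : 'I_k -> R, forall p, L i p = \sum_r g r * cell_prob p r) ->
  exists (phi : counts k n -> R) (A B : R),
    [/\ is_test phi, 0 < B & forall p, power phi p = A - B * \prod_i L i p].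
Proof.
move=> k0 /choice[g gE].
pose w (f : {ffun 'I_n -> 'I_k}) := \prod_i g i (f i).
pose M := \sum_f `|w f|.
pose psi := sample_average R k n (fun f => M - w f).
have psi0 y : 0 <= psi y.
  rewrite /psi /sample_average divr_ge0 ?divr_ge0 ?ler0n //.
  apply: sumr_ge0 => f _; rewrite subr_ge0 (le_trans (ler_norm _)) //.
  by rewrite /M (bigD1 f) //= lerDl sumr_ge0.
pose K := 1 + \sum_y psi y.
have K0 : 0 < K by rewrite /K ltr_pwDl // sumr_ge0.
exists (fun y => K^-1 * psi y), (K^-1 * M), K^-1; split=> [y||p].
- rewrite mulr_ge0 ?invr_ge0 ?(ltW K0) //= mulrC ler_pdivrMr // mul1r.
  by rewrite /K (bigD1 y) //= addrCA lerDl addr_ge0 // sumr_ge0.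
- by rewrite invr_gt0.
have -> : power (fun y => K^-1 * psi y) p = K^-1 * power psi p.
  by rewrite /power mulr_sumr; apply: eq_bigr => y _; rewrite [RHS]mulrA.
rewrite -mulrBr; congr (_ * _); rewrite [LHS](power_sample_average R k n _ p).
rewrite (eq_bigr _ (fun f _ => mulrBl _ _ _)) sumrB -mulr_sumr; congr (_ - _).
  rewrite -(bigA_distr_bigA (fun _ r => cell_prob p r)) big1 ?mulr1 // => i _.
  exact: sum_cell_prob.
under [RHS]eq_bigr do rewrite gE.
rewrite bigA_distr_bigA; apply: eq_bigr => f _.
by rewrite big_split.
Qed.

(** * Geometry of the polytope inside the simplex *)

Lemma dotrv_segment (R : realType) (d : nat) (u x y : 'rV[R]_d) (c t : R) :
  dotrv u (x + t *: (y - x)) - c =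
  (1 - t) * (dotrv u x - c) + t * (dotrv u y - c).
Proof. by rewrite dotrvD dotrvZ dotrvB; ring. Qed.

Lemma cell_prob_segment (R : realType) (k : nat) (x y : 'rV[R]_k.-1) (t : R)
    (r : 'I_k) :
  cell_prob (x + t *: (y - x)) r = (1 - t) * cell_prob x r + t * cell_prob y r.
Proof. by rewrite !cell_probE dotrv_segment. Qed.

Lemma null_polytopeP (R : realType) (k m : nat) (a : 'I_m -> 'rV[R]_k.-1)
    (b : 'I_m -> R) (p : 'rV[R]_k.-1) : (0 < k)%N ->
  null_polytope a b p <->
  (forall r, 0 <= cell_prob p r) /\ forall i, 0 <= dotrv (a i) p - b i.
Proof.
by move=> k0; split=> -[/(proj_simplexP _ _ _ k0) pT pP]; split.
Qed.

Lemma not_boundary_simplex (R : realType) (k : nat) (p : 'rV[R]_k.-1) :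
  (1 < k)%N -> proj_simplex R k.-1 p ->
  ~ boundary (proj_simplex R k.-1) p <-> forall r, 0 < cell_prob p r.
Proof.
move=> k1 pT; split=> [pB|p0 [_]]; last first.
  by apply; apply/interior_proj_simplexP.
apply/interior_proj_simplexP => //; apply: contrapT => pI.
by apply: pB; split=> //; exact: subset_closure.
Qed.

(** The facet affinely spans its hyperplane, so any other constraint tight on the whole facet would
    define the same hyperplane. Hence each other constraint, cell or polytope, is strict at some
    point of the facet, and averaging makes all of them strict at once. *)
Lemma facet_relint (R : realType) (k m : nat) (a : 'I_m -> 'rV[R]_k.-1)
    (b : 'I_m -> R) (i : 'I_m) : (1 < k)%N ->
  (forall j, a j <> 0) ->
  (forall j, i <> j -> hyperplane (a i) (b i) <> hyperplane (a j) (b j)) ->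
  has_affine_dim (hyperplane (a i) (b i) `&` null_polytope a b) k.-2 ->
  hyperplane (a i) (b i) `&` interior (proj_simplex R k.-1) !=set0 ->
  exists x, [/\ dotrv (a i) x = b i,
    forall j, j != i -> 0 < dotrv (a j) x - b j &
    forall r, 0 < cell_prob x r].
Proof.
case: k a => [|[|d]] // a k1 a0 ab Fdim [q [Hq /interior_proj_simplexP qT]].
set F := _ `&` _ in Fdim.
have Fhull a' b' : a' != 0 -> F `<=` hyperplane a' b' ->
    hyperplane (a i) (b i) = hyperplane a' b'.
  move=> a'0 FH; rewrite -(affine_hull_hyperplane _ _ _ _ _ a'0 FH Fdim).
  apply/esym/affine_hull_hyperplane => //; first by apply/eqP/a0.
  by move=> p [].
(* This yields a point of the facet: an affine combination has total weight 1, so it is not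
   empty. *)
have : affine_hull F q.
  rewrite (affine_hull_hyperplane _ _ (a i) (b i)) //; first exact/eqP/a0.
  by move=> p [].
move=> [[|r] [z [w [Fz w1 _]]]].
  by move: w1; rewrite big_ord0 => /esym/eqP; rewrite oner_eq0.
pose g (s : 'I_d.+2 + 'I_m) := match s with
  | inl r => cell_normal R d.+2 r | inr j => a j end.
pose c (s : 'I_d.+2 + 'I_m) := match s with
  | inl r => cell_offset R d.+2 r | inr j => b j end.
have FE p : F p <-> dotrv (a i) p = b i /\ forall s, 0 <= dotrv (g s) p - c s.
  split=> [[Hp /null_polytopeP[//|p1 p2]]|[Hp gp]]; split=> //.
    by case=> [s|j]; [have := p1 s; rewrite cell_probE | exact: p2].
  apply/null_polytopeP => //; split=> [s|j]; last exact: (gp (inr j)).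
  by rewrite cell_probE; exact: (gp (inl s)).
have Fg s : g s != 0 -> hyperplane (a i) (b i) <> hyperplane (g s) (c s) ->
    exists2 p, F p & 0 < dotrv (g s) p - c s.
  move=> gs0 Hgs; apply: contrapT => N; apply: Hgs; apply: Fhull => // p Fp.
  apply/eqP; rewrite eq_le -subr_le0 -[X in _ && X]subr_ge0.
  have [_ ->] := (FE p).1 Fp; rewrite andbT leNgt; apply/negP => gp.
  by apply: N; exists p.
have [||x [Hx _] gx] := average_gt0 _ _ _ (a i) (b i) g c
    [pred s | s != inr i].
- by exists (z ord0); apply/FE.
- case=> [s|j] /= => [_|ji].
    have [||p /FE Fp gp] := Fg (inl s); last by exists p.
      exact: (cell_normal_neq0 R d.+2 s).
    (* If the hyperplane were that of a cell, the interior point [q] on it would have a zero cell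
       probability. *)
    move=> HE; have := qT k1 s; rewrite cell_probE subr_gt0.
    by have : hyperplane (a i) (b i) q by []; rewrite HE => ->; rewrite ltxx.
  have [||p /FE Fp gp] := Fg (inr j); last by exists p.
    exact/eqP/a0.
  by apply: ab => ij; move/eqP: ji; rewrite ij.
exists x; split=> // [j ji|s]; first exact: (gx (inr j)).
by rewrite cell_probE; exact: (gx (inl s)).
Qed.

(* The first constraint violated on the way from the facet to [q] would be
   tight, together with the [i]-th one, at an interior point of the simplex. *)
Lemma hyperplane_in_polytope (R : realType) (k m : nat)
    (a : 'I_m -> 'rV[R]_k.-1) (b : 'I_m -> R) (i : 'I_m) (x q : 'rV[R]_k.-1) :
  dotrv (a i) x = b i -> (forall j, j != i -> 0 < dotrv (a j) x - b j) ->
  (forall r, 0 < cell_prob x r) ->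
  (forall j p, j != i -> (forall r, 0 < cell_prob p r) ->
    (forall l, 0 <= dotrv (a l) p - b l) ->
    dotrv (a i) p = b i -> dotrv (a j) p = b j -> False) ->
  (forall r, 0 < cell_prob q r) -> dotrv (a i) q = b i ->
  forall l, 0 <= dotrv (a l) q - b l.
Proof.
move=> xi xj xT no_meet qT qi l0; rewrite leNgt; apply/negP => ql0.
pose L l p := dotrv (a l) p - b l.
(* For [l] violated at [q], [t l] is the parameter where [L l] vanishes on the segment from [x] to
   [q]; the minimal one gives the first constraint met. *)
pose t l := L l x / (L l x - L l q).
case: (@arg_minP _ R _ l0 [pred l | L l q < 0] t ql0) => j /= qj jmin.
have ji : j != i by apply: contraTneq qj => ->; rewrite /L qi subrr ltxx.
have Lx0 l : 0 <= L l x.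
  have [->|li] := eqVneq l i; first by rewrite /L xi subrr.
  exact/ltW/xj.
have xj0 : 0 < L j x by exact: xj.
have dj : 0 < L j x - L j q by lra.
have t0 : 0 < t j by exact: divr_gt0.
have t1 : t j < 1 by rewrite /t ltr_pdivrMr //; lra.
have tE l : L l q < 0 -> t l * (L l x - L l q) = L l x.
  by move=> ql; rewrite divfK //; have := Lx0 l; lra.
apply: (no_meet j (x + t j *: (q - x))) => //.
- by move=> r; rewrite cell_prob_segment; have := xT r; have := qT r; nra.
- move=> l; rewrite dotrv_segment -/(L l x) -/(L l q); have Lxl := Lx0 l.
  have [ql|ql] := ltP (L l q) 0; last by nra.
  have := tE l ql; have := jmin l ql; nra.
- by apply/eqP; rewrite -subr_eq0 dotrv_segment xi qi !subrr !mulr0 addr0.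
apply/eqP; rewrite -subr_eq0 dotrv_segment -/(L j x) -/(L j q).
by apply/eqP; have := tE j qj; lra.
Qed.

(* If the [j]-th constraint were also violated or tight at [p], the segment from
   the [j]-th facet to [p] would meet the [i]-th hyperplane at an interior point
   where the [j]-th affine function is nonpositive. *)
Lemma single_violation (R : realType) (k m : nat)
    (a : 'I_m -> 'rV[R]_k.-1) (b : 'I_m -> R) :
  (forall i, exists x, [/\ dotrv (a i) x = b i,
    forall j, j != i -> 0 < dotrv (a j) x - b j & forall r, 0 < cell_prob x r]) ->
  (forall i j p, j != i -> (forall r, 0 < cell_prob p r) ->
    (forall l, 0 <= dotrv (a l) p - b l) ->
    dotrv (a i) p = b i -> dotrv (a j) p = b j -> False) ->
  forall i j p, (forall r, 0 <= cell_prob p r) -> dotrv (a i) p - b i < 0 ->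
  j != i -> 0 < dotrv (a j) p - b j.
Proof.
move=> relint no_meet i j p pT pi ji; rewrite ltNge; apply/negP => pj.
have [x [xj xi xT]] := relint j.
have xi0 : 0 < dotrv (a i) x - b i by apply: xi; rewrite eq_sym.
set A := dotrv (a i) x - b i in xi0; set B := dotrv (a i) p - b i in pi.
have d0 : 0 < A - B by lra.
(* The parameter where the [i]-th affine function vanishes on the segment from [x] to [p]. *)
pose t := A / (A - B).
have t0 : 0 < t by exact: divr_gt0.
have t1 : t < 1 by rewrite /t ltr_pdivrMr //; lra.
have tE : t * (A - B) = A by rewrite divfK // gt_eqF.
pose w := x + t *: (p - x).
have wT r : 0 < cell_prob w r.
  by rewrite cell_prob_segment; have := xT r; have := pT r; nra.
have wi : dotrv (a i) w = b i.
  by apply/eqP; rewrite -subr_eq0 dotrv_segment -/A -/B; apply/eqP; lra.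
have [y [yi yj yT]] := relint i.
have wP := hyperplane_in_polytope _ _ _ _ _ _ _ _ yi yj yT (no_meet i) wT wi.
apply: (no_meet i j w) => //; apply/eqP; rewrite -subr_eq0 eq_le wP andbT.
by rewrite dotrv_segment xj subrr mulr0 add0r mulr_ge0_le0 // ltW.
Qed.

(** * Sufficiency: the product of the constraints as a test *)

Lemma exists_SUB (R : realType) (k m : nat)
    (a : 'I_m -> 'rV[R]_k.-1) (b : 'I_m -> R) : (0 < k)%N ->
  (forall i j p, (forall r, 0 <= cell_prob p r) -> dotrv (a i) p - b i < 0 ->
    j != i -> 0 < dotrv (a j) p - b j) ->
  exists (n : nat) (phi : counts k n -> R), is_test phi /\
    SUB phi (null_polytope a b) (proj_simplex R k.-1 `\` null_polytope a b).
Proof.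
(* One observation per constraint, that is, per factor of the product. *)
move=> k0 single; exists m.
have [i|phi [A [B [phi01 B0 phiE]]]] :=
  exists_test_prod R k m (fun i p => dotrv (a i) p - b i) k0.
  exact: affine_cell_prob.
exists phi; split=> // p q /null_polytopeP[//|_ p0] [/proj_simplexP qT qP].
rewrite !phiE ltrD2l ltrN2 ltr_pM2l //.
apply: (@lt_le_trans _ _ 0); last by apply: prodr_ge0 => i _; exact: p0.
have [i qi] : exists i, dotrv (a i) q - b i < 0.
  apply: contrapT => N; apply: qP; apply/null_polytopeP => //.
  split=> [|i]; first exact: qT.
  by rewrite leNgt; apply/negP => qi; apply: N; exists i.
rewrite (bigD1 i) //= nmulr_rlt0 //; apply: prodr_gt0 => j ji.
by apply: single ji => //; exact: qT.
Qed.

(** * Necessity: the parity contradiction *)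

Lemma unbiased_threshold (R : realType) (k n : nat) (phi : counts k n -> R)
    (P0 PA : set 'rV[R]_k.-1) :
  unbiased phi P0 PA -> P0 !=set0 -> PA !=set0 ->
  exists c, (forall p, P0 p -> power phi p <= c) /\
            (forall p, PA p -> c <= power phi p).
Proof.
move=> phiU [p0 P0p0] [pA PApA]; pose E := [set power phi p | p in P0].
exists (sup E); split=> p Pp.
  by apply: ub_le_sup; [exists (power phi pA) => _ [q Pq <-]; exact: phiU | exists p].
by apply: ge_sup => [|_ [q Pq <-]]; [exists (power phi p0), p0 | exact: phiU].
Qed.

(** On the line through [z] with direction [a], both the power minus [c] and the affine function are
    nonzero polynomials, so some point of it is a root of neither. Such a point gives a plane
    transversal to the hyperplane on which the power is not identically [c]. *)
Lemma power_neq_off_hyperplane (R : realType) (k n : nat) (phi : counts k n -> R)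
    (a z : 'rV[R]_k.-1) (b c : R) :
  a != 0 -> power phi z <> c ->
  exists z', power phi z' <> c /\ dotrv a z' <> b.
Proof.
move=> a0 zc; have [F FE] := power_plane R k n phi z a 0.
pose P := F.[0%:P] - c%:P; pose Q := (dotrv a z - b)%:P + dotrv a a *: 'X.
have PE s : P.[s] = power phi (z + s *: a) - c.
  by rewrite !hornerE FE scaler0 addr0.
have QE s : Q.[s] = dotrv a (z + s *: a) - b.
  by rewrite !hornerE dotrvD dotrvZ; ring.
have P0 : P != 0.
  apply: contra_notN zc => /eqP P0; have := PE 0.
  by rewrite P0 horner0 scale0r addr0 => /esym/eqP; rewrite subr_eq0 => /eqP.
have Q0 : Q != 0.
  apply: contraTneq (dotrvv_gt0 _ _ _ a0) => Q0.
  have := QE 0; have := QE 1; rewrite Q0 !horner0 scale0r scale1r addr0 dotrvD.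
  by move=> H1 H2; rewrite -leNgt; lra.
have [s] := filter_ex (horner_neq0_near _ _ 0 (mulf_neq0 P0 Q0)).
rewrite hornerM mulf_eq0 negb_or PE QE !subr_eq0 => /andP[/eqP ? /eqP ?].
by exists (z + s *: a).
Qed.

Lemma step_beyond (R : realType) (k : nat) (q x : 'rV[R]_k.-1) :
  (forall r, 0 < cell_prob q r) -> exists e : R, 0 < e /\
    forall r, 0 < cell_prob (q + (- e) *: (x - q)) r.
Proof.
move=> qT.
pose f r (e : R) := 0 < cell_prob q r + e * (cell_prob q r - cell_prob x r).
have H : \forall e \near 0, forall r, predT r -> f r e.
  apply: (@forall_in_near R _ predT f 0) => r _.
  by apply: affine_gt0_near; rewrite mul0r addr0.
have [e [e0 fe]] := filter_ex (filterI (nbhs_right_gt 0) (cvg_within _ H)).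
exists e; split=> // r; have := fe r isT.
by rewrite /f cell_prob_segment; lra.
Qed.

Lemma unbiased_no_meet (R : realType) (k m n : nat) (a : 'I_m -> 'rV[R]_k.-1)
    (b : 'I_m -> R) (phi : counts k n -> R) (i j : 'I_m) (x q : 'rV[R]_k.-1) :
  (0 < k)%N -> (forall i, a i != 0) ->
  NTUB phi (null_polytope a b) (proj_simplex R k.-1 `\` null_polytope a b) ->
  null_polytope a b !=set0 ->
  proj_simplex R k.-1 `\` null_polytope a b !=set0 ->
  dotrv (a i) x = b i -> (forall l, l != i -> 0 < dotrv (a l) x - b l) ->
  (forall r, 0 < cell_prob x r) ->
  j != i -> (forall r, 0 < cell_prob q r) ->
  dotrv (a i) q = b i -> dotrv (a j) q = b j -> False.
Proof.
move=> k0 a0 [phiU phiN] P0n PAn xi xl xT ji qT qi qj.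
have [c [fP0 fPA]] := unbiased_threshold _ _ _ _ _ _ phiU P0n PAn.
have [z0 z0c] : exists z, power phi z <> c.
  apply: contrapT => N; apply: phiN; exists c => p _; apply: contrapT => pc.
  by apply: N; exists p.
have [z [zc zi]] := power_neq_off_hyperplane _ _ _ _ _ _ (b i) _ (a0 i) z0c.
(* The line through [x] and [q] lies in the [i]-th hyperplane. The [j]-th affine function is
   positive at [x] and zero at [q], hence negative at [y], just beyond [q] and still interior. *)
have [e [e0 yT]] := step_beyond _ _ q x qT.
pose y := q + (- e) *: (x - q); pose v := z - x.
have yj : dotrv (a j) y - b j < 0.
  rewrite dotrv_segment qj subrr mulr0 add0r mulNr oppr_lt0.
  by rewrite mulr_gt0 // xl.
have yi : dotrv (a i) y - b i = 0.
  by rewrite dotrv_segment qi xi !subrr !mulr0 addr0.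
(* In these coordinates [t = 0] is the line in the hyperplane, [x] and [y] are at [s = 0] and
   [s = 1], and [z] is at [s = 0], [t = 1]. *)
have [F0 F0E] := power_plane R k n phi x (y - x) v.
pose F := F0 - c%:P%:P; pose pt s t := x + s *: (y - x) + t *: v.
have FE s t : F.[t%:P].[s] = power phi (pt s t) - c.
  by rewrite /F !hornerE F0E.
have F_neq0 : F != 0.
  apply: contra_notN zc => /eqP F00; have := FE 0 1.
  rewrite F00 !horner0 /pt /v scale0r scale1r addr0 [x + _]addrC subrK.
  by move=> /esym/eqP; rewrite subr_eq0 => /eqP.
have ptE u d s t : dotrv u (pt s t) - d =
    (dotrv u x - d) + s * (dotrv u y - dotrv u x) + t * dotrv u v.
  by rewrite /pt dotrvD dotrvD !dotrvZ dotrvB; ring.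
have ptcell s t r : cell_prob (pt s t) r = cell_prob x r
    + s * (cell_prob y r - cell_prob x r) + t * dotrv (cell_normal R k r) v.
  by rewrite !cell_probE ptE; ring.
have pti s t : dotrv (a i) (pt s t) - b i = t * dotrv (a i) v.
  by rewrite ptE xi subrr add0r (subr0_eq yi) subrr mulr0 add0r.
have vi : dotrv (a i) v != 0.
  by rewrite dotrvB xi subr_eq0; apply/eqP.
have [d parity] := parity_near_line R F F_neq0.
have outside l p : (forall r, 0 < cell_prob p r) -> dotrv (a l) p - b l < 0 ->
    c <= power phi p.
  move=> pT pl; apply: fPA; split.
    by apply/proj_simplexP => // r; exact: ltW.
  by move=> /null_polytopeP[//|_ /(_ l)]; rewrite leNgt pl.
(* Near [x] all constraints but the [i]-th are strict, so one of the points for [t] and [- t] is in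
   the polytope and the other in the alternative. The product of the two values of [F] is thus
   nonpositive, and its strict sign forces [d] to be odd. *)
have odd_d : odd d.
  pose u s := match s with inl r => cell_prob x r | inr l => dotrv (a l) x - b l end.
  pose u' s := match s with inl r => cell_prob y r - cell_prob x r
    | inr l => dotrv (a l) y - dotrv (a l) x end.
  pose w s := match s with inl r => dotrv (cell_normal R k r) v
    | inr l => dotrv (a l) v end.
  have [|s [t [t0 pos neg]]] := parity ('I_k + 'I_m)%type
    [pred s | s != inr i] u u' w 0.
    by case=> [r|l] /= li; rewrite mul0r addr0; [exact: xT | exact: xl].
  have inside t' : 0 <= t' * dotrv (a i) v ->
      (forall s', s' != inr i -> 0 < u s' + s * u' s' + t' * w s') ->
      power phi (pt s t') <= c.
    move=> t'0 H; apply: fP0; apply/null_polytopeP => //; split=> [r|l].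
      by rewrite ptcell ltW //; exact: (H (inl r)).
    have [->|li] := eqVneq l i; first by rewrite pti.
    by rewrite ptE ltW //; exact: (H (inr l)).
  have cells t' : (forall s', s' != inr i -> 0 < u s' + s * u' s' + t' * w s') ->
      forall r, 0 < cell_prob (pt s t') r.
    by move=> H r; rewrite ptcell; exact: (H (inl r)).
  rewrite !FE -signr_odd; case: (odd d) => //; rewrite expr0 mul1r ltNge.
  have /orP[tv|tv] : (t * dotrv (a i) v < 0) || (0 < t * dotrv (a i) v).
    by rewrite -neq_lt mulf_neq0.
  - rewrite mulr_ge0_le0 // ?subr_ge0 ?subr_le0.
      by apply: (outside i); [exact: cells | rewrite pti].
    by apply: inside => //; rewrite mulNr oppr_ge0 ltW.
  rewrite mulr_le0_ge0 // ?subr_ge0 ?subr_le0.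
    by apply: inside => //; exact: ltW.
  by apply: (outside i); [exact: cells | rewrite pti mulNr oppr_lt0].
(* Near [y] the [j]-th constraint stays violated (the index [None]), so both points are in the
   alternative and the product is nonnegative, against the odd parity. *)
pose u s := if s is Some r then cell_prob x r else - (dotrv (a j) x - b j).
pose u' s := if s is Some r then cell_prob y r - cell_prob x r
  else - (dotrv (a j) y - dotrv (a j) x).
pose w s := if s is Some r then dotrv (cell_normal R k r) v
  else - dotrv (a j) v.
have [|s [t [t0 pos neg]]] := parity (option 'I_k) predT u u' w 1.
  by case=> [r|] _ /=; [have := yT r; rewrite -/y; lra | lra].
have out t' : (forall s', predT s' -> 0 < u s' + s * u' s' + t' * w s') ->
    0 <= power phi (pt s t') - c.
  move=> H; rewrite subr_ge0; apply: (outside j) => [r|].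
    by rewrite ptcell; exact: (H (Some r)).
  by rewrite ptE; have := H None isT; rewrite /=; lra.
rewrite !FE -signr_odd odd_d expr1 mulN1r oppr_gt0 ltNge.
by rewrite mulr_ge0 // out.
Qed.

(** * Assembly of the two equivalences *)

Lemma SUB_NTUB (R : realType) (k m n : nat) (a : 'I_m -> 'rV[R]_k.-1)
    (b : 'I_m -> R) (phi : counts k n -> R) :
  null_polytope a b !=set0 ->
  proj_simplex R k.-1 `\` null_polytope a b !=set0 ->
  SUB phi (null_polytope a b) (proj_simplex R k.-1 `\` null_polytope a b) ->
  NTUB phi (null_polytope a b) (proj_simplex R k.-1 `\` null_polytope a b).
Proof.
move=> [p P0p] [q PAq] phiS; split=> [p' q' P0p' PAq'|[c phic]].
  exact/ltW/phiS.
have := phiS p q P0p PAq; rewrite !phic ?ltxx //; first by case: PAq.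
by case: P0p.
Qed.

Theorem theorem2 (R : realType) (k : nat) (hk : (2 <= k)%N) (m : nat)
    (a : 'I_m -> 'rV[R]_k.-1) (b : 'I_m -> R)
    (hdim : has_affine_dim (null_polytope a b) k.-1)
    (hne : null_polytope a b <> set0)
    (hproper : null_polytope a b <> proj_simplex R k.-1)
    (hplane : forall i, a i <> 0)
    (hdistinct : forall i j, i <> j ->
       hyperplane (a i) (b i) <> hyperplane (a j) (b j))
    (hfacet : forall i,
       has_affine_dim (hyperplane (a i) (b i) `&` null_polytope a b) k.-2)
    (hint : forall i,
       hyperplane (a i) (b i) `&` interior (proj_simplex R k.-1) !=set0) :
  ((exists (n : nat) (phi : counts k n -> R), is_test phi /\
      NTUB phi (null_polytope a b)
        (proj_simplex R k.-1 `\` null_polytope a b))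
   <-> (forall i j, i <> j ->
          hyperplane (a i) (b i) `&` hyperplane (a j) (b j)
            `&` null_polytope a b `<=` boundary (proj_simplex R k.-1)))
  /\
  ((exists (n : nat) (phi : counts k n -> R), is_test phi /\
      SUB phi (null_polytope a b)
        (proj_simplex R k.-1 `\` null_polytope a b))
   <-> (forall i j, i <> j ->
          hyperplane (a i) (b i) `&` hyperplane (a j) (b j)
            `&` null_polytope a b `<=` boundary (proj_simplex R k.-1))).
Proof.
have k0 : (0 < k)%N := ltnW hk.
have a0 i : a i != 0 by apply/eqP.
have P0n : null_polytope a b !=set0 by apply/set0P/eqP.
have PAn : proj_simplex R k.-1 `\` null_polytope a b !=set0.
  apply/set0P/eqP; rewrite setD_eq0 => TP.
  by apply: hproper; apply/seteqP; split=> // p [].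
have relint i := facet_relint R k m a b i hk hplane
  (hdistinct i) (hfacet i) (hint i).
set C := forall i j, _.
(* Both equivalences follow from a cycle: an NTUB test gives [C], [C] gives an SUB test, and an SUB
   test is NTUB. *)
have NTUB_C : (exists (n : nat) (phi : counts k n -> R), is_test phi /\
    NTUB phi (null_polytope a b) (proj_simplex R k.-1 `\` null_polytope a b)) -> C.
  move=> [n [phi [_ phiN]]] i j ij q [[qi qj] qP]; apply: contrapT => qB.
  have [x [xi xl xT]] := relint i.
  apply: (unbiased_no_meet R k m n a b phi i j x q) => //.
    by apply/eqP => ji; exact: ij.
  by apply/not_boundary_simplex => //; case: qP.
have C_SUB : C -> exists (n : nat) (phi : counts k n -> R), is_test phi /\
    SUB phi (null_polytope a b) (proj_simplex R k.-1 `\` null_polytope a b).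
  move=> HC; apply: exists_SUB => //; apply: single_violation => //.
  move=> i j p /eqP ji pT pP pi pj.
  have pP0 : null_polytope a b p.
    by apply/null_polytopeP => //; split=> // r; exact: ltW.
  apply: ((not_boundary_simplex R k p hk _).2 pT); first by case: pP0.
  by apply: (HC i j) => // ij; exact: ji.
have SUB_NTUB_ex : (exists (n : nat) (phi : counts k n -> R), is_test phi /\
    SUB phi (null_polytope a b) (proj_simplex R k.-1 `\` null_polytope a b)) ->
  exists (n : nat) (phi : counts k n -> R), is_test phi /\
    NTUB phi (null_polytope a b) (proj_simplex R k.-1 `\` null_polytope a b).
  by move=> [n [phi [phi01 phiS]]]; exists n, phi; split=> //; exact: SUB_NTUB.
by split; split; auto.
Qed.
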